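(* Let $f:\mathbb R^n\to\overline{\mathbb R}$, $\bar x\in\mathbb R^n$ with $f(\bar x)$ finite, and let $u\in\mathbb R^n$, $u\ne0$. Suppose that $f$ is locally lower semicontinuous at $\bar x$ in direction $u$ and continuous at $\bar x$ in direction $u$. Then $f$ is Lipschitz continuous around $\bar x$ in direction $u$ if and only if $\partial^\infty f(\bar x;u)=\{0\}$.
   Context: $\overline{\mathbb R}=[-\infty,\infty]$, $\mathbb B$ is the open unit ball, $\mathbb B_\varepsilon(z)$ the open ball of radius $\varepsilon$ at $z$, and overlines on sets denote closure. For $d\in\mathbb R^n$, $\varepsilon,\delta>0$: $\mathcal V_{\varepsilon,\delta}(d)=\{z\in\varepsilon\mathbb B : \big\|\,\|d\|z-\|z\|d\,\big\|\le\delta\|z\|\|d\|\}$. $x^k\xrightarrow{u}\bar x$ means there are $t_k\downarrow0$ $(t_k>0)$, $u^k\to u$ with $x^k=\bar x+t_ku^k$. $f$ is locally lower semicontinuous at $\bar x$ in direction $u$ if there are $\varepsilon,\delta>0$ such that $\mathrm{epi} f\cap\big(\overline{\bar x+\mathcal V_{\varepsilon,\delta}(u)}\times\overline{\mathbb B}_\varepsilon(f(\bar x))\big)$ is closed, where $\mathrm{epi} f=\{(x,r)\in\mathbb R^n\times\mathbb R: f(x)\le r\}$. $f$ is continuous at $\bar x$ in direction $u$ if $f(x^k)\to f(\bar x)$ for every $x^k\xrightarrow{u}\bar x$. $f$ is Lipschitz continuous around $\bar x$ in direction $u$ if there are $L\ge0$, $\varepsilon,\delta>0$ such that $f$ is finite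 on $\bar x+\mathcal V_{\varepsilon,\delta}(u)$ and $|f(x)-f(x')|\le L\|x-x'\|$ for all $x,x'\in\bar x+\mathcal V_{\varepsilon,\delta}(u)$. Regular subdifferential at $x$ with $f(x)$ finite: $\widehat\partial f(x)=\{\xi: f(x')\ge f(x)+\langle\xi,x'-x\rangle+o(\|x'-x\|)\}$. Directional singular subdifferential: $\partial^\infty f(\bar x;u)=\{\xi:\exists x^k\xrightarrow{u}\bar x,\ \tau_k\downarrow0,\ \xi^k\in\widehat\partial f(x^k),\ \tau_k\xi^k\to\xi,\ f(x^k)\to f(\bar x)\}$. *)

(* Defs.v *)
From mathcomp Require Import all_boot all_order all_algebra.
From mathcomp Require Import all_classical all_reals all_analysis.

Set Implicit Arguments.
Unset Strict Implicit.
Unset Printing Implicit Defensive.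

Import Order.TTheory GRing.Theory Num.Theory.
Import numFieldNormedType.Exports.

Local Open Scope classical_set_scope.
Local Open Scope ring_scope.

Section Directional.
Context {R : realType} {n : nat}.
Implicit Types (f : 'rV[R]_n -> \bar R) (x u d : 'rV[R]_n).

Definition dotv (v w : 'rV[R]_n) : R := \sum_i v 0 i * w 0 i.

(* The library norm on 'rV[R]_n is the sup norm, hence a separate Euclidean
   norm; both induce the library topology, which is used for limits, closures
   and neighborhoods. *)
Definition enorm (v : 'rV[R]_n) : R := Num.sqrt (dotv v v).

Definition dir_nbhd (e delta : R) d : set 'rV[R]_n :=
  [set z | enorm z < e /\
           enorm (enorm d *: z - enorm z *: d) <= delta * enorm z * enorm d].

Definition dir_nbhd_at x (e delta : R) d : set 'rV[R]_n :=
  [set x + z | z in dir_nbhd e delta d].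

(* "t_k decreases to 0" is read as: t_k > 0 and t_k tends to 0, without
   monotonicity. *)
Definition cvg0_pos (t : nat -> R) : Prop :=
  (forall k, 0 < t k) /\ t @ \oo --> (0 : R).

Definition dir_cvg (xs : nat -> 'rV[R]_n) x u : Prop :=
  exists (t : nat -> R) (us : nat -> 'rV[R]_n),
    [/\ cvg0_pos t, us @ \oo --> u & forall k, xs k = x + t k *: us k].

Definition epi f : set ('rV[R]_n * R) := [set p | (f p.1 <= p.2%:E)%E].

Definition dir_locally_lsc f x u : Prop :=
  exists e delta : R, [/\ 0 < e, 0 < delta &
    closed (epi f `&`
      (closure (dir_nbhd_at x e delta u) `*` closed_ball (fine (f x)) e))].

Definition dir_continuous f x u : Prop :=
  forall xs : nat -> 'rV[R]_n, dir_cvg xs x u -> f (xs k) @[k --> \oo] --> f x.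

Definition dir_lipschitz f x u : Prop :=
  exists L e delta : R, [/\ 0 <= L, 0 < e, 0 < delta,
    (forall y, dir_nbhd_at x e delta u y -> f y \is a fin_num) &
    (forall y z, dir_nbhd_at x e delta u y -> dir_nbhd_at x e delta u z ->
       `|fine (f y) - fine (f z)| <= L * enorm (y - z))].

(* Empty where f is infinite. *)
Definition regular_subdiff f x : set 'rV[R]_n :=
  [set xi | f x \is a fin_num /\
    exists r : 'rV[R]_n -> R,
      r =o_x (fun y : 'rV[R]_n => enorm (y - x)) /\
      \forall y \near x, (f x + (dotv xi (y - x) + r y)%:E <= f y)%E].

Definition dir_singular_subdiff f x u : set 'rV[R]_n :=
  [set xi | exists (xs : nat -> 'rV[R]_n) (tau : nat -> R)
                   (xis : nat -> 'rV[R]_n),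
    [/\ dir_cvg xs x u, cvg0_pos tau,
        (forall k, regular_subdiff f (xs k) (xis k)),
        tau k *: xis k @[k --> \oo] --> xi &
        f (xs k) @[k --> \oo] --> f x]].

End Directional.

(* Main.v *)
Require Import Defs.
From mathcomp Require Import all_boot all_order all_algebra.
From mathcomp Require Import all_classical all_reals all_analysis.
From mathcomp Require Import ring lra.
Import Order.TTheory GRing.Theory Num.Theory.
Import numFieldNormedType.Exports.
Local Open Scope classical_set_scope.
Local Open Scope ring_scope.

(** The set [xbar + V_{e,delta}(u)] is, apart from its tip, squeezed between
    translated open convex cones [<z, u> > c |z| |u|] with [c < 1], so it
    suffices to work on such cones.

    If [f] is Lipschitz on a cone, the subgradients there are bounded by the
    Lipschitz constant, hence every singular subgradient vanishes.  That [0] is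
    one follows from lower semicontinuity: minimizing [f + M |. - p|^2] over a
    small ball around a point [p] of the cone gives points arbitrarily close to
    [xbar] in direction [u] where the regular subdifferential is nonempty.

    Conversely, if [0] is the only singular subgradient, then by compactness of
    the unit ball the regular subgradients in some cone are bounded by a
    constant [L].  For [K > L] and [p] in the cone, a minimizer [y <> p] of
    [f + K |. - p| + M |. - p|^2] in the interior of a ball around [p] would
    carry a subgradient of norm [>= K].  As [M] large forces the minimizer into
    the interior, the minimizer is [p] itself, so
    [f p <= f z + K |z - p| + M |z - p|^2].  Applied along fine
    subdivisions of a segment this yields the Lipschitz constant [K].  The
    point [xbar] is reached through directional continuity. *)

(** * The Euclidean norm and its agreement with the library topology *)

Section Euclidean.
Context {R : realType} {n : nat}.
Implicit Types (v w x y z : 'rV[R]_n) (a r : R).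

Lemma dotvC v w : dotv v w = dotv w v.
Proof. by apply: eq_bigr => i _; rewrite mulrC. Qed.

Lemma dotvDl v w z : dotv (v + w) z = dotv v z + dotv w z.
Proof. by rewrite -big_split; apply: eq_bigr => i _; rewrite mxE mulrDl. Qed.

Lemma dotvZl a v z : dotv (a *: v) z = a * dotv v z.
Proof. by rewrite mulr_sumr; apply: eq_bigr => i _; rewrite mxE mulrA. Qed.

Lemma dotvNl v z : dotv (- v) z = - dotv v z.
Proof. by rewrite -scaleN1r dotvZl mulN1r. Qed.

Lemma dotvDr v w z : dotv z (v + w) = dotv z v + dotv z w.
Proof. by rewrite dotvC dotvDl !(dotvC z). Qed.

Lemma dotvZr a v z : dotv z (a *: v) = a * dotv z v.
Proof. by rewrite dotvC dotvZl (dotvC z). Qed.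

Lemma dotvNr v z : dotv z (- v) = - dotv z v.
Proof. by rewrite dotvC dotvNl (dotvC z). Qed.

Definition dotvE := (dotvDl, dotvDr, dotvZl, dotvZr, dotvNl, dotvNr).

Lemma dotvv_ge0 v : 0 <= dotv v v.
Proof. by apply: sumr_ge0 => i _; rewrite -expr2 sqr_ge0. Qed.

Lemma sqr_enorm v : enorm v ^+ 2 = dotv v v.
Proof. by rewrite sqr_sqrtr// dotvv_ge0. Qed.

Lemma enorm_ge0 v : 0 <= enorm v.
Proof. exact: sqrtr_ge0. Qed.

Lemma coord_le_enorm v i : `|v 0 i| <= enorm v.
Proof.
rewrite -ler_sqr ?nnegrE ?enorm_ge0// sqr_enorm real_normK ?num_real//.
rewrite /dotv (bigD1 i)//= -expr2 lerDl.
by apply: sumr_ge0 => j _; rewrite -expr2 sqr_ge0.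
Qed.

Lemma enorm_eq0 v : (enorm v == 0) = (v == 0).
Proof.
apply/eqP/eqP => [v0|->]; last first.
  by rewrite /enorm /dotv big1 ?sqrtr0// => i _; rewrite mxE mul0r.
apply/rowP => i; rewrite mxE; apply/eqP; rewrite -normr_le0.
by rewrite -v0 coord_le_enorm.
Qed.

Lemma enorm0 : enorm (0 : 'rV[R]_n) = 0.
Proof. by apply/eqP; rewrite enorm_eq0. Qed.

Lemma enorm_gt0 v : (0 < enorm v) = (v != 0).
Proof. by rewrite lt_def enorm_ge0 enorm_eq0 andbT. Qed.

(** The left side being a square, this identity contains the Cauchy-Schwarz inequality. It also
    turns the inequality defining [dir_nbhd] into a bound on an angle. *)
Lemma sqr_enorm_dir v w : enorm (enorm w *: v - enorm v *: w) ^+ 2 =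
  2 * (enorm v * enorm w) * (enorm v * enorm w - dotv v w).
Proof. by rewrite sqr_enorm !dotvE -!sqr_enorm (dotvC w v); ring. Qed.

Lemma dotv_le v w : dotv v w <= enorm v * enorm w.
Proof.
have [->|v0] := eqVneq v 0.
  by rewrite enorm0 mul0r /dotv big1// => i _; rewrite mxE mul0r.
have [->|w0] := eqVneq w 0.
  by rewrite enorm0 mulr0 /dotv big1// => i _; rewrite mxE mulr0.
have := sqr_ge0 (enorm (enorm w *: v - enorm v *: w)).
by rewrite sqr_enorm_dir pmulr_rge0 ?subr_ge0// !mulr_gt0// enorm_gt0.
Qed.

Lemma enormZ a v : enorm (a *: v) = `|a| * enorm v.
Proof.
by rewrite /enorm dotvZl dotvZr mulrA -expr2 sqrtrM ?sqr_ge0// sqrtr_sqr.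
Qed.

Lemma enormN v : enorm (- v) = enorm v.
Proof. by rewrite -scaleN1r enormZ normrN1 mul1r. Qed.

Lemma enormBC v w : enorm (v - w) = enorm (w - v).
Proof. by rewrite -enormN opprB. Qed.

Lemma enormD v w : enorm (v + w) <= enorm v + enorm w.
Proof.
rewrite -ler_sqr ?nnegrE ?addr_ge0 ?enorm_ge0// sqr_enorm !dotvE.
have := dotv_le v w; rewrite sqrrD !sqr_enorm (dotvC w v).
by lra.
Qed.

Lemma norm_le_enorm v : `|v| <= enorm v.
Proof.
rewrite [leLHS]mx_normrE; apply/bigmax_leP; split; first exact: enorm_ge0.
by move=> [i j] _ /=; rewrite ord1 coord_le_enorm.
Qed.

(** The crude factor [n.+1] avoids a square root and stays positive for [n = 0], so that radii can
    be divided by it. *)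
Lemma enorm_le_norm v : enorm v <= n.+1%:R * `|v|.
Proof.
rewrite -ler_sqr ?nnegrE ?enorm_ge0 ?mulr_ge0// sqr_enorm exprMn.
apply: (@le_trans _ _ (\sum_(i < n) `|v| ^+ 2)).
  apply: ler_sum => i _; rewrite -expr2 -real_normK ?num_real//.
  rewrite lerXn2r ?nnegrE// [leRHS]mx_normrE.
  by apply/bigmax_geP; right => /=; exists (0, i).
rewrite sumr_const card_ord -[leLHS]mulr_natl ler_wpM2r ?sqr_ge0//.
by rewrite -natrX ler_nat expnS mulSn (leq_trans (leqnSn _)) ?leq_addr.
Qed.

Lemma near_enormP x (P : 'rV[R]_n -> Prop) : (\forall y \near x, P y) <->
  exists2 r, 0 < r & forall y, enorm (y - x) < r -> P y.
Proof.
split=> [/nbhs_ballP[r/= r0 rP]|[r r0 rP]].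
  exists r => // y yx; apply: rP; rewrite -ball_normE/= distrC.
  exact: le_lt_trans (norm_le_enorm _) yx.
apply/nbhs_ballP; exists (r / n.+1%:R) => /=; first by rewrite divr_gt0.
move=> y; rewrite -ball_normE/= distrC ltr_pdivlMr// mulrC => yx.
by apply: rP; apply: le_lt_trans (enorm_le_norm _) yx.
Qed.

Lemma cvg_enormP (xs : nat -> 'rV[R]_n) x :
  xs @ \oo --> x <-> enorm (xs k - x) @[k --> \oo] --> (0 : R).
Proof.
split=> [/cvgrPdist_lt cvx|/cvgrPdist_lt cvx].
  apply/cvgrPdist_lt => e e0; have e0' : 0 < e / n.+1%:R by rewrite divr_gt0.
  near=> k; rewrite distrC subr0 ger0_norm ?enorm_ge0//.
  apply: le_lt_trans (enorm_le_norm _) _; rewrite mulrC -ltr_pdivlMr// distrC.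
  by near: k; exact: cvx.
apply/cvgrPdist_lt => e e0; near=> k; rewrite distrC.
apply: le_lt_trans (norm_le_enorm _) _.
rewrite -(ger0_norm (enorm_ge0 _)) -[X in `|X|]subr0 distrC.
by near: k; exact: cvx.
Unshelve. all: by end_near. Qed.

Lemma dist_enorm_continuous x : continuous (fun y => enorm (y - x)).
Proof.
move=> y; apply/(@cvgrPdist_lt _ _ _ (nbhs y)) => e e0.
apply/near_enormP; exists e => // z zy.
have := enormD (z - y) (y - x); have := enormD (y - z) (z - x).
rewrite !addrA !subrK (enormBC y z) ltr_norml => h1 h2.
by apply/andP; split; lra.
Qed.

Lemma closed_enorm_ball x r : closed [set y | enorm (y - x) <= r].
Proof.
rewrite -openC openE => y /= /negP; rewrite -ltNge => ry.
apply/near_enormP; exists (enorm (y - x) - r); first by rewrite subr_gt0.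
move=> z zy /= zr; have := enormD (y - z) (z - x).
by rewrite addrA subrK (enormBC y z) => h; lra.
Qed.

Lemma compact_enorm_ball x r : compact [set y | enorm (y - x) <= r].
Proof.
apply: bounded_closed_compact; last exact: closed_enorm_ball.
exists (`|r| + enorm x); split; first exact: num_real.
move=> M rM y /= yr; apply: le_trans (ltW rM).
apply: le_trans (norm_le_enorm _) _; rewrite -(subrK x y).
apply: le_trans (enormD _ _) _; rewrite lerD2r.
exact: le_trans yr (ler_norm _).
Qed.

End Euclidean.

(** * Minimizers and subgradients by penalization *)

Lemma lsc_min (R : realType) (T : topologicalType) (D : set T) (g : T -> R)
    (m : R) :
  compact D -> D !=set0 -> (forall y, D y -> m <= g y) ->
  (forall y, D y -> forall e, 0 < e ->
     \forall z \near y, D z -> g y - e < g z) ->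
  exists2 y, D y & forall z, D z -> g y <= g z.
Proof.
move=> Dc [y0 Dy0] mg lsc.
have infE : has_inf (g @` D).
  by split; [exists (g y0), y0|exists m => _ [y Dy <-]; exact: mg].
have /choice[ys ysP] k : exists y, D y /\ g y < inf (g @` D) + k.+1%:R^-1.
  have [||_ [y Dy <-] gy] := @inf_adherent _ (g @` D) k.+1%:R^-1 => //.
  by exists y.
have [|y [Dy cly]] := Dc (ys @ \oo) _.
  by exists 0%N => // k _; exact: (ysP k).1.
exists y => // z Dz; apply: (@le_trans _ _ (inf (g @` D))); last first.
  by apply: ge_inf; [exact: infE.2|exists z].
apply/ler_addgt0Pr => e e0.
have e2 : 0 < e / 2 by rewrite divr_gt0.
have tail : \forall k \near \oo, D (ys k) /\ g (ys k) < inf (g @` D) + e / 2.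
  near=> k; split; first exact: (ysP k).1.
  apply: lt_trans (ysP k).2 _; rewrite ltrD2l.
  by near: k; exact: (near_infty_natSinv_lt (PosNum e2)).
(* The neighborhood of the cluster point [y] given by semicontinuity meets the tail of the
   minimizing sequence, so [g y] is less than the infimum plus [e]. *)
have [w [[Dw gw] /(_ Dw)]] :=
  cly [set z | D z /\ g z < inf (g @` D) + e / 2] _ tail (lsc _ Dy _ e2).
by move=> h; apply: ltW; lra.
Unshelve. all: by end_near. Qed.

Section Penalization.
Context {R : realType} {n : nat}.
Implicit Types (f : 'rV[R]_n -> \bar R) (x y z w h xi : 'rV[R]_n).

(** Proximal subgradients are regular, a quadratic error being of smaller order than the
    distance. *)
Lemma regular_subdiff_quadratic f y xi (C : R) : f y \is a fin_num ->
  (\forall z \near y,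
     (f y + (dotv xi (z - y) - C * enorm (z - y) ^+ 2)%:E <= f z)%E) ->
  regular_subdiff f y xi.
Proof.
move=> fy yP; split=> //; exists (fun z => - (C * enorm (z - y) ^+ 2)).
split=> //; apply/eqoP => e e0; apply/near_enormP.
exists (e / (`|C| + 1)); first by rewrite divr_gt0// ltr_wpDl.
move=> z zy; rewrite normrN normrM normrX !(ger0_norm (enorm_ge0 _)) expr2 mulrA.
rewrite ler_wpM2r ?enorm_ge0//; move: zy; rewrite ltr_pdivlMr ?ltr_wpDl// => zy.
have := enorm_ge0 (z - y); move: zy; rewrite mulrDr mulr1 mulrC; lra.
Qed.

(* The sublinear term rests on [2 a s <= s^2 + a^2] with [a = enorm w] and
   [s = enorm (w + h)]. *)
Lemma penalty_upper (K M : R) w h : 0 <= K -> K = 0 \/ w != 0 ->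
  K * enorm (w + h) + M * enorm (w + h) ^+ 2 <=
  K * enorm w + M * enorm w ^+ 2 + dotv ((K / enorm w + 2 * M) *: w) h
  + (K / (2 * enorm w) + M) * enorm h ^+ 2.
Proof.
move=> K0 Kw.
have sE : enorm (w + h) ^+ 2 = enorm w ^+ 2 + 2 * dotv w h + enorm h ^+ 2.
  by rewrite !sqr_enorm !dotvE (dotvC h w); ring.
suff : K * enorm (w + h) <=
    K * enorm w + K / enorm w * dotv w h + K / (2 * enorm w) * enorm h ^+ 2.
  by rewrite dotvZl sE; lra.
have [->|K_neq0] := eqVneq K 0; first by rewrite !mul0r !addr0.
have {}Kw : w != 0 by case: Kw => // K_eq0; rewrite K_eq0 eqxx in K_neq0.
have a0 : 0 < enorm w by rewrite enorm_gt0.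
have -> : K * enorm w + K / enorm w * dotv w h
    + K / (2 * enorm w) * enorm h ^+ 2 =
    K * ((enorm (w + h) ^+ 2 + enorm w ^+ 2) / (2 * enorm w)).
  by rewrite sE; field; rewrite gt_eqF.
rewrite ler_wpM2l// ler_pdivlMr ?mulr_gt0//.
by have := sqr_ge0 (enorm (w + h) - enorm w); lra.
Qed.

(** As [M * rho ^+ 2] exceeds any drop of [f] below its value at [x], no minimizer lies on the
    sphere of radius [rho]. At an interior minimizer, the opposite of the gradient of the penalty is
    a subgradient of [f]; this gradient exists if [K = 0] or [y != x]. *)
Lemma penalized_min f x (rho K M : R) : 0 < rho -> 0 <= K -> 0 <= M ->
  (forall y, enorm (y - x) <= rho -> f y \is a fin_num) ->
  (forall y, enorm (y - x) <= rho -> forall e, 0 < e ->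
     \forall z \near y, enorm (z - x) <= rho -> fine (f y) - e < fine (f z)) ->
  (forall y, enorm (y - x) <= rho ->
     fine (f x) - fine (f y) < M * rho ^+ 2) ->
  let g y := fine (f y) + (K * enorm (y - x) + M * enorm (y - x) ^+ 2) in
  exists y, [/\ enorm (y - x) < rho,
    forall z, enorm (z - x) <= rho -> g y <= g z &
    K = 0 \/ y != x -> exists2 xi, regular_subdiff f y xi &
      enorm xi = K + 2 * M * enorm (y - x)].
Proof.
move=> rho0 K0 M0 fin lsc osc g.
have pen_ge0 y : 0 <= K * enorm (y - x) + M * enorm (y - x) ^+ 2.
  by rewrite addr_ge0 ?mulr_ge0 ?sqr_ge0 ?enorm_ge0.
have Dx : enorm (x - x) <= rho by rewrite subrr enorm0 ltW.
have gx : g x = fine (f x) by rewrite /g subrr enorm0 expr0n !mulr0 !addr0.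
have [||y Dy e e0|y Dy ymin] := @lsc_min R _ [set y | enorm (y - x) <= rho] g
    (fine (f x) - M * rho ^+ 2) (compact_enorm_ball _ _).
- by exists x.
- by move=> y /osc; have := pen_ge0 y; rewrite /g; lra.
- have pen_cont : {for y, continuous
      (fun z => K * enorm (z - x) + M * enorm (z - x) ^+ 2)}.
    have pc : continuous (fun t : R => K * t + M * t ^+ 2).
      move=> t; apply: cvgD; apply: cvgMl_tmp; first exact: cvg_id.
      exact: exprn_continuous.
    exact: (continuous_comp (@dist_enorm_continuous _ _ x y) (pc _)).
  have e2 : 0 < e / 2 by rewrite divr_gt0.
  have /cvgrPdist_lt/(_ _ e2) H := pen_cont.
  apply: filterS2 (lsc _ Dy _ e2) H => z + + Dz => /(_ Dz).
  by rewrite /g ltr_norml => h1 /andP[h2 h3]; lra.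
have yx : enorm (y - x) < rho.
  rewrite lt_neqAle Dy andbT; apply/eqP => yE.
  have := ymin _ Dx; rewrite gx /g; have := osc _ Dy.
  have : 0 <= K * enorm (y - x) by rewrite mulr_ge0 ?enorm_ge0.
  by rewrite yE; lra.
exists y; split=> // Kyx.
(* The gradient of the penalty at [y] is [c *: (y - x)]. For [K = 0] the quotient is 0, even if
   [y = x]. *)
pose c := K / enorm (y - x) + 2 * M.
have c0 : 0 <= c by rewrite addr_ge0 ?divr_ge0 ?mulr_ge0 ?enorm_ge0.
exists (- (c *: (y - x))); last first.
  rewrite enormN enormZ ger0_norm// /c mulrDl; congr (_ + _).
  have [->|K_neq0] := eqVneq K 0; first by rewrite !mul0r.
  rewrite divfK// enorm_eq0 subr_eq0.
  by case: Kyx => // K_eq0; rewrite K_eq0 eqxx in K_neq0.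
apply: (@regular_subdiff_quadratic _ _ _ (K / (2 * enorm (y - x)) + M)).
  exact: fin.
apply/near_enormP; exists (rho - enorm (y - x)); first by rewrite subr_gt0.
move=> z zy; have Dz : enorm (z - x) <= rho.
  by have := enormD (z - y) (y - x); rewrite addrA subrK => h; lra.
rewrite -(fineK (fin _ Dy)) -(fineK (fin _ Dz)) -EFinD lee_fin.
have := ymin _ Dz; rewrite /g => gyz.
(* By minimality [f] decreases from [y] to [z] by at most the growth of the penalty, which is linear
   up to a quadratic term. *)
have /(@penalty_upper K M (y - x) (z - y) K0) : K = 0 \/ y - x != 0.
  by rewrite subr_eq0.
rewrite [y - x + (z - y)]addrC addrA subrK -/c dotvNl; lra.
Qed.

End Penalization.

(** * Lipschitz estimates and bounds on subgradients *)

Section SubgradientBounds.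
Context {R : realType} {n : nat}.
Implicit Types (f : 'rV[R]_n -> \bar R) (x y z xi : 'rV[R]_n).

(** The subgradient inequality is tested at [x + s *: xi], where its linear term is [enorm xi] times
    the distance to [x]. *)
Lemma enorm_regular_subdiff_le f x xi (L : R) : 0 <= L ->
  (\forall y \near x, f y \is a fin_num /\
     fine (f y) - fine (f x) <= L * enorm (y - x)) ->
  regular_subdiff f x xi -> enorm xi <= L.
Proof.
move=> L0 /near_enormP[r1 r1_gt0 fL].
move=> [fx [r [/eqoP ro /near_enormP[r2 r2_gt0 xiP]]]].
have [->|xi0] := eqVneq xi 0; first by rewrite enorm0.
have a0 : 0 < enorm xi by rewrite enorm_gt0.
apply/ler_addgt0Pr => e e0.
have /near_enormP[r3 r3_gt0 re] := ro _ e0.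
pose m := Num.min r1 (Num.min r2 r3).
have m0 : 0 < m by rewrite !lt_min r1_gt0 r2_gt0.
(* This puts [y] at distance [m / 2] from [x], inside all three balls. *)
pose s := m / 2 / enorm xi; have s0 : 0 < s by rewrite !divr_gt0.
pose y := x + s *: xi.
have yx : y - x = s *: xi by rewrite /y addrC addKr.
have nyx : enorm (y - x) = s * enorm xi by rewrite yx enormZ gtr0_norm.
have : enorm (y - x) < m.
  by rewrite nyx /s divfK ?gt_eqF// ltr_pdivrMr// ltr_pMr// ltr1n.
rewrite !lt_min => /and3P[/fL[fy fyL] /xiP + /re].
rewrite -(fineK fx) -(fineK fy) -EFinD lee_fin.
rewrite (ger0_norm (enorm_ge0 _)) ler_norml => h1 /andP[h2 _].
rewrite -(ler_pM2l (mulr_gt0 s0 a0)).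
have dE : dotv xi (y - x) = s * enorm xi * enorm xi.
  by rewrite yx dotvZr -sqr_enorm expr2 mulrA.
rewrite mulrDr; move: fyL h1 h2; rewrite dE nyx.
move: (s * enorm xi) => sa; lra.
Qed.

(** The requirement on [M] involves only [rho] and the bound [c] on the drop of [f], not [x], so one
    [M] serves all points of a segment. *)
Lemma subdiff_lower_estimate f x (rho c K L M : R) :
  0 < rho -> 0 <= K -> L < K -> 0 <= M -> c < M * rho ^+ 2 ->
  (forall y, enorm (y - x) <= rho ->
     [/\ f y \is a fin_num, fine (f x) - fine (f y) <= c,
       (forall e, 0 < e -> \forall z \near y, fine (f y) - e < fine (f z)) &
       (forall xi, regular_subdiff f y xi -> enorm xi <= L)]) ->
  forall z, enorm (z - x) <= rho -> fine (f x) - fine (f z) <=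
    K * enorm (z - x) + M * enorm (z - x) ^+ 2.
Proof.
move=> rho0 K0 LK M0 cM H z zx.
have [|||y [yx ymin xiP]] := @penalized_min _ _ f x rho K M rho0 K0 M0.
- by move=> y /H[].
- move=> y /H[_ _ lsc _] e e0.
  by apply: filterS (lsc _ e0) => w + _.
- by move=> y /H[_ + _ _] => /le_lt_trans; apply.
have [yE|y_neq_x] := eqVneq y x.
  have := ymin _ zx; rewrite yE subrr enorm0 expr0n !mulr0 !addr0; lra.
have [xi fxi xiE] := xiP (or_intror y_neq_x).
have [_ _ _ /(_ _ fxi)] := H _ (ltW yx); rewrite xiE => xiL.
have : 0 <= 2 * M * enorm (y - x) by rewrite !mulr_ge0 ?enorm_ge0.
by lra.
Qed.

(* The error term [M * d ^+ 2] of the lower estimate is uniform along the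
   segment, so subdividing the segment into [N] pieces divides it by [N]. *)
Lemma lipschitz_of_subdiff_bound f (O : set 'rV[R]_n) (c K L : R) :
  open O ->
  (forall a b (s : R), O a -> O b -> 0 <= s <= 1 -> O (a + s *: (b - a))) ->
  0 <= K -> L < K ->
  (forall y, O y ->
     [/\ f y \is a fin_num, (forall x, O x -> fine (f x) - fine (f y) <= c),
       (forall e, 0 < e -> \forall z \near y, fine (f y) - e < fine (f z)) &
       (forall xi, regular_subdiff f y xi -> enorm xi <= L)]) ->
  forall a b, O a -> O b -> fine (f a) - fine (f b) <= K * enorm (a - b).
Proof.
rewrite openE => Oo Oconv K0 LK H a b Oa Ob.
have /near_enormP[r1 r1_gt0 r1O] := Oo _ Oa.
have /near_enormP[r2 r2_gt0 r2O] := Oo _ Ob.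
have [rho [rho0 rho1 rho2]] : exists rho, [/\ 0 < rho, rho < r1 & rho < r2].
  exists (Num.min r1 r2 / 2).
  by have : 0 < Num.min r1 r2 /\ Num.min r1 r2 <= r1 /\ Num.min r1 r2 <= r2;
    [rewrite lt_min r1_gt0 !ge_min !lexx orbT|split; lra].
pose p (s : R) := a + s *: (b - a).
(* A whole tube around the segment lies in [O]: [z] is on the segment between the translates of [a]
   and [b] by [z - p s], and these are in [O]. *)
have pO s z : 0 <= s <= 1 -> enorm (z - p s) <= rho -> O z.
  move=> s01 zp; have -> : z =
      (a + (z - p s)) + s *: ((b + (z - p s)) - (a + (z - p s))).
    by apply/rowP => i; rewrite !mxE; ring.
  by apply: Oconv => //; [apply: r1O|apply: r2O]; rewrite addrC addKr; lra.
have [M M0 cM] : exists2 M, 0 <= M & c < M * rho ^+ 2.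
  exists ((`|c| + 1) / rho ^+ 2); first by rewrite divr_ge0 ?sqr_ge0 ?addr_ge0.
  by rewrite divfK ?expf_neq0 ?gt_eqF// (le_lt_trans (ler_norm c))// ltrDl.
pose d := enorm (a - b); have d0 : 0 <= d by exact: enorm_ge0.
apply/ler_addgt0Pr => e e0; rewrite -/d.
(* The first summand makes the pieces shorter than [rho], the second makes the accumulated quadratic
   error at most [e]. *)
pose t := d / rho + M * d ^+ 2 / e.
have t0 : 0 <= t.
  by rewrite addr_ge0 ?divr_ge0 ?mulr_ge0 ?sqr_ge0 ?(ltW e0) ?(ltW rho0).
pose N := Num.bound t; have tN : t < N%:R := archi_boundP t0.
have N0 : 0 < N%:R :> R by exact: le_lt_trans tN.
have dN : d / N%:R <= rho.
  rewrite ler_pdivrMr// mulrC -ler_pdivrMr//; apply: le_trans (ltW tN).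
  by rewrite lerDl divr_ge0 ?mulr_ge0 ?sqr_ge0 ?(ltW e0).
have MN : M * d ^+ 2 / N%:R <= e.
  rewrite ler_pdivrMr// [e * _]mulrC -ler_pdivrMr//; apply: le_trans (ltW tN).
  by rewrite lerDr divr_ge0 ?(ltW rho0).
pose q i := p (i%:R / N%:R).
have iN i : (i <= N)%N -> 0 <= (i%:R : R) / N%:R <= 1.
  by move=> i_le; rewrite divr_ge0 ?ler0n// ler_pdivrMr// mul1r ler_nat.
have step i : (i < N)%N -> fine (f (q i)) - fine (f (q i.+1)) <=
    K * (d / N%:R) + M * (d / N%:R) ^+ 2.
  move=> i_lt; have qq : enorm (q i.+1 - q i) = d / N%:R.
    rewrite /q /p opprD addrACA subrr add0r -scalerBl -mulrBl -natrB// subSnn.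
    by rewrite enormZ ger0_norm ?divr_ge0 ?ler0n// mul1r mulrC enormBC.
  rewrite -qq; apply: (@subdiff_lower_estimate f _ rho c K L M) => //.
    move=> y /(pO _ _ (iN _ (ltnW i_lt)))/H[fy cy lsc sub]; split=> //.
    apply/cy/(pO _ _ (iN _ (ltnW i_lt))).
    by rewrite subrr enorm0 ltW.
  by rewrite qq.
have tele i : (i <= N)%N -> fine (f a) - fine (f (q i)) <=
    i%:R * (K * (d / N%:R) + M * (d / N%:R) ^+ 2).
  elim: i => [_|i IH i_lt].
    by rewrite /q /p mul0r scale0r addr0 subrr mul0r.
  by have := IH (ltnW i_lt); have := step _ i_lt; rewrite -natr1 mulrDl mul1r; lra.
have := tele _ (leqnn N).
rewrite /q divff ?gt_eqF// /p scale1r [a + _]addrC subrK => h.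
apply: le_trans h _; apply: le_trans (_ : _ <= K * d + M * d ^+ 2 / N%:R) _.
  by rewrite le_eqVlt; apply/orP; left; apply/eqP; field; rewrite gt_eqF.
by rewrite lerD2l.
Qed.

End SubgradientBounds.

(** * Directional neighborhoods as cones, and directional convergence *)

Section Cones.
Context {R : realType} {n : nat}.
Implicit Types (u v w x y z : 'rV[R]_n) (c e delta s t : R).

(** Here [c] is a lower bound for the cosine of the angle with [u]. Strictness makes the set open
    and removes the tip 0. *)
Definition open_cone e c u : set 'rV[R]_n :=
  [set z | enorm z < e /\ c * (enorm z * enorm u) < dotv z u].

(** By [sqr_enorm_dir], squaring the defining inequality and dividing by [2 * (enorm z * enorm u)]
    gives the bound on the cosine. At [z = 0] both inequalities are trivial. *)
Lemma dir_nbhdE e delta u z : 0 < delta -> u != 0 -> dir_nbhd e delta u z <->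
  enorm z < e /\ (1 - delta ^+ 2 / 2) * (enorm z * enorm u) <= dotv z u.
Proof.
move=> d0 u0; rewrite /dir_nbhd/=.
suff -> : (enorm (enorm u *: z - enorm z *: u) <= delta * enorm z * enorm u) =
    ((1 - delta ^+ 2 / 2) * (enorm z * enorm u) <= dotv z u) by [].
rewrite -ler_sqr ?nnegrE ?mulr_ge0 ?enorm_ge0 ?(ltW d0)// sqr_enorm_dir.
have [->|z0] := eqVneq z 0.
  rewrite enorm0 !(mul0r, mulr0) expr0n lexx.
  by have := dotv_le (0 : 'rV[R]_n) u; rewrite /dotv big1 ?lexx// => i _;
    rewrite mxE mul0r.
have p0 : 0 < enorm z * enorm u by rewrite mulr_gt0 ?enorm_gt0.
have -> : (delta * enorm z * enorm u) ^+ 2 =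
    delta ^+ 2 * (enorm z * enorm u) ^+ 2 by ring.
move: (enorm z * enorm u) (dotv z u) p0 => p q p0.
have -> : delta ^+ 2 * p ^+ 2 = 2 * p * (delta ^+ 2 / 2 * p) by field.
by rewrite ler_pM2l ?mulr_gt0//; apply/idP/idP; lra.
Qed.

Lemma open_cone_neq0 e c u z : open_cone e c u z -> z != 0.
Proof.
by apply: contraPneq => -> [_]; rewrite enorm0 mul0r mulr0 /dotv big1 ?ltxx// =>
  i _; rewrite mxE mul0r.
Qed.

(** For [c] nonnegative, [c * (enorm z * enorm u) - dotv z u] is a convex function of [z]. *)
Lemma open_cone_convex e c u a b s : 0 <= c -> open_cone e c u a ->
  open_cone e c u b -> 0 <= s <= 1 -> open_cone e c u (a + s *: (b - a)).
Proof.
move=> c0 [ae ca] [be cb] /andP[s0 s1].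
have -> : a + s *: (b - a) = (1 - s) *: a + s *: b.
  by rewrite scalerBr scalerBl scale1r addrA addrAC.
have nab : enorm ((1 - s) *: a + s *: b) <= (1 - s) * enorm a + s * enorm b.
  apply: le_trans (enormD _ _) _.
  by rewrite !enormZ (ger0_norm s0) ger0_norm ?subr_ge0.
(* At least one of the two weights is positive, so strictness survives. *)
have conv_lt (p q p' q' : R) : p < p' -> q < q' ->
    (1 - s) * p + s * q < (1 - s) * p' + s * q'.
  move=> pp qq; have [->|s_neq0] := eqVneq s 0; first by lra.
  have s_gt0 : 0 < s by rewrite lt_def s_neq0.
  by rewrite ler_ltD ?ltr_pM2l// ler_wpM2l ?subr_ge0// ltW.
split.
  by apply: le_lt_trans nab _; have := conv_lt _ _ _ _ ae be; lra.
rewrite dotvDl !dotvZl; apply: le_lt_trans (conv_lt _ _ _ _ ca cb).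
apply: (@le_trans _ _ (c * (((1 - s) * enorm a + s * enorm b) * enorm u))).
  by rewrite ler_wpM2l// ler_wpM2r// enorm_ge0.
by rewrite le_eqVlt; apply/orP; left; apply/eqP; ring.
Qed.

Lemma open_cone_near e c u z : open_cone e c u z ->
  \forall w \near z, open_cone e c u w.
Proof.
move=> [ze cz].
have nU : 0 < (`|c| + 1) * (enorm u + 1).
  by apply: mulr_gt0; rewrite ltr_wpDl ?enorm_ge0.
pose g := dotv z u - c * (enorm z * enorm u).
have g0 : 0 < g by rewrite subr_gt0.
apply/near_enormP.
(* The gap [g] varies with [z] at rate at most [(|c| + 1) * enorm u]. Using [enorm u + 1] keeps the
   divisor positive when [u = 0]. *)
exists (Num.min (e - enorm z) (g / (2 * ((`|c| + 1) * (enorm u + 1))))).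
  by rewrite lt_min subr_gt0 ze divr_gt0// (mulr_gt0 _ nU).
move=> w; rewrite lt_min => /andP[wz].
rewrite ltr_pdivlMr ?(mulr_gt0 _ nU)// => wzg.
have wn := enormD (w - z) z; have zn := enormD (z - w) w.
rewrite !subrK (enormBC z w) in wn zn.
split; first by lra.
have du : - (enorm (w - z) * enorm u) <= dotv (w - z) u.
  by have := dotv_le (- (w - z)) u; rewrite enormN dotvNl; lra.
have cu : c * (enorm w * enorm u) <= c * (enorm z * enorm u)
    + `|c| * (enorm (w - z) * enorm u).
  rewrite -lerBlDl -mulrBr -mulrBl.
  apply: le_trans (ler_norm _) _; rewrite !normrM (ger0_norm (enorm_ge0 u)).
  rewrite ler_wpM2l// ler_wpM2r ?enorm_ge0// ler_norml; lra.
rewrite dotvDl dotvNl in du.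
have : enorm (w - z) * enorm u + `|c| * (enorm (w - z) * enorm u) < g.
  apply: le_lt_trans wzg.
  have -> : enorm (w - z) * enorm u + `|c| * (enorm (w - z) * enorm u) =
     enorm (w - z) * ((`|c| + 1) * enorm u) by ring.
  rewrite ler_wpM2l ?enorm_ge0//.
  have : 0 <= (`|c| + 1) * enorm u by rewrite mulr_ge0 ?enorm_ge0 ?addr_ge0.
  have : 0 <= `|c| by []. have := enorm_ge0 u. by lra.
by rewrite /g; lra.
Qed.

Lemma open_cone_at_open x e c u : open [set y | open_cone e c u (y - x)].
Proof.
rewrite openE => y /= /open_cone_near/near_enormP[r r0 rP].
apply/near_enormP; exists r => // z zy; apply: rP.
by rewrite opprB addrA subrK.
Qed.

Lemma open_coneS e e' c c' u : e <= e' -> c' <= c ->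
  open_cone e c u `<=` open_cone e' c' u.
Proof.
move=> ee cc z [ze zc]; split; first exact: lt_le_trans ee.
by apply: le_lt_trans zc; rewrite ler_wpM2r// mulr_ge0 ?enorm_ge0.
Qed.

Lemma open_coneZ e c u t : c < 1 -> u != 0 -> 0 < t -> t * enorm u < e ->
  open_cone e c u (t *: u).
Proof.
move=> c1 u0 t0 te; split; first by rewrite enormZ gtr0_norm.
rewrite enormZ gtr0_norm// dotvZl -sqr_enorm -mulrA -expr2.
by rewrite gtr_pMl// mulr_gt0// exprn_gt0// enorm_gt0.
Qed.

Lemma open_cone_dir_nbhd e delta u z : 0 < delta -> u != 0 ->
  open_cone e (1 - delta ^+ 2 / 2) u z -> dir_nbhd e delta u z.
Proof. by move=> d0 u0 [ze cz]; apply/dir_nbhdE => //; split=> //; exact: ltW. Qed.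

Lemma dir_nbhd_open_cone e delta c u z : 0 < delta -> u != 0 -> z != 0 ->
  c < 1 - delta ^+ 2 / 2 -> dir_nbhd e delta u z -> open_cone e c u z.
Proof.
move=> d0 u0 z0 cd /(dir_nbhdE _ _ _ _ d0 u0)[ze cz]; split=> //.
by apply: lt_le_trans cz; rewrite ltr_pM2r// mulr_gt0 ?enorm_gt0.
Qed.

Lemma dir_cvg_dir_nbhd x u (zs : nat -> 'rV[R]_n) : u != 0 ->
  (forall k, zs k != 0) ->
  (forall k, dir_nbhd k.+1%:R^-1 k.+1%:R^-1 u (zs k)) ->
  dir_cvg (fun k => x + zs k) x u.
Proof.
move=> u0 zs0 zsP.
have a0 : 0 < enorm u by rewrite enorm_gt0.
have b0 k : 0 < enorm (zs k) by rewrite enorm_gt0.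
(* The directions are rescaled to the length of [u]; dividing the inequality of [dir_nbhd] by
   [enorm (zs k)] then bounds their distance to [u] by [enorm u / k.+1]. *)
exists (fun k => enorm (zs k) / enorm u),
  (fun k => (enorm u / enorm (zs k)) *: zs k); split.
- split=> [k|]; first by rewrite divr_gt0.
  rewrite -[X in _ --> X](mul0r (enorm u)^-1); apply: cvgMr_tmp.
  apply: (@squeeze_cvgr _ _ _ _ (fun=> 0) (@harmonic R)).
  + by near=> k; rewrite enorm_ge0 ltW//; exact: (zsP k).1.
  + exact: cvg_cst.
  + exact: cvg_harmonic.
- apply/cvg_enormP; rewrite -[X in _ --> X](mul0r (enorm u)).
  apply: (@squeeze_cvgr _ _ _ _ (fun=> 0) (fun k => @harmonic R k * enorm u)).
  + near=> k; rewrite enorm_ge0/=.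
    have -> : (enorm u / enorm (zs k)) *: zs k - u =
       (enorm (zs k))^-1 *: (enorm u *: zs k - enorm (zs k) *: u).
      by rewrite scalerBr !scalerA mulVf ?gt_eqF// scale1r mulrC.
    rewrite enormZ gtr0_norm ?invr_gt0// mulrC ler_pdivrMr// mulrAC.
    exact: (zsP k).2.
  + by rewrite mul0r; exact: cvg_cst.
  + by apply: cvgMr_tmp; exact: cvg_harmonic.
- move=> k; rewrite scalerA.
  have -> : enorm (zs k) / enorm u * (enorm u / enorm (zs k)) = 1.
    by field; rewrite !gt_eqF.
  by rewrite scale1r.
Unshelve. all: by end_near. Qed.

(** Passes from sequences to neighborhoods: counterexamples at every scale would form a sequence
    converging in direction [u]. The index in [P] lets a bound grow as the neighborhood shrinks. *)
Lemma dir_nbhd_dir_cvg x u (P : nat -> 'rV[R]_n -> Prop) : u != 0 ->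
  (forall xs, dir_cvg xs x u -> exists k, P k (xs k)) ->
  exists k, forall z, z != 0 -> dir_nbhd k.+1%:R^-1 k.+1%:R^-1 u z ->
    P k (x + z).
Proof.
move=> u0 H; apply: contrapT => nP.
have /choice[zs zsP] k : exists z, [/\ z != 0,
    dir_nbhd k.+1%:R^-1 k.+1%:R^-1 u z & ~ P k (x + z)].
  apply: contrapT => nz; apply: nP; exists k => z z0 zk.
  by apply: contrapT => nPz; apply: nz; exists z.
have [|k] := H (fun k => x + zs k).
  by apply: dir_cvg_dir_nbhd => // k; case: (zsP k).
by case: (zsP k).
Qed.

(** The angle condition is invariant under scaling and open, and [u] satisfies it; hence so do the
    directions [us k] eventually. *)
Lemma dir_cvg_open_cone (xs : nat -> 'rV[R]_n) x u e c : u != 0 -> c < 1 ->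
  0 < e -> dir_cvg xs x u -> \forall k \near \oo, open_cone e c u (xs k - x).
Proof.
move=> u0 c1 e0 [t [us [[t0 ct] cu xsE]]].
have a0 : 0 < enorm u by rewrite enorm_gt0.
have u1 : open_cone (enorm u + 1) c u u.
  rewrite -[X in open_cone _ _ _ X]scale1r; apply: open_coneZ => //.
  by rewrite mul1r ltrDl.
have usP := cu _ (open_cone_near _ _ _ _ u1).
have e1 : 0 < e / (enorm u + 1) by rewrite divr_gt0// ltr_wpDl ?enorm_ge0.
have /cvgrPdist_lt/(_ _ e1) tP := ct.
near=> k; have tk0 := t0 k.
have [uk1 uk2] : open_cone (enorm u + 1) c u (us k) by near: k.
have tk : t k < e / (enorm u + 1).
  rewrite -(gtr0_norm tk0) -normrN -sub0r; by near: k.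
rewrite xsE addrC addKr; split.
  rewrite enormZ gtr0_norm//; rewrite ltr_pdivlMr ?ltr_wpDl ?enorm_ge0// in tk.
  by apply: lt_trans tk; rewrite ltr_pM2l.
by rewrite enormZ gtr0_norm// dotvZl -mulrA mulrCA ltr_pM2l.
Unshelve. all: by end_near. Qed.

End Cones.

(** * Continuity and lower semicontinuity on a cone *)

Section DirectionalContinuity.
Context {R : realType} {n : nat}.
Variables (f : 'rV[R]_n -> \bar R) (x u : 'rV[R]_n).
Hypotheses (f_fin : f x \is a fin_num) (u0 : u != 0)
  (f_lsc : dir_locally_lsc f x u) (f_cont : dir_continuous f x u).

Let fE : f x = (fine (f x))%:E. Proof. by rewrite fineK. Qed.

Lemma dir_continuous_cone (eta : R) : 0 < eta -> exists e c : R,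
  [/\ 0 < e, 0 <= c, c < 1 & forall y, open_cone e c u (y - x) ->
    f y \is a fin_num /\ `|fine (f y) - fine (f x)| < eta].
Proof.
move=> eta0.
have [xs xsP|k kP] := dir_nbhd_dir_cvg x u (fun _ y =>
    f y \is a fin_num /\ `|fine (f y) - fine (f x)| < eta) u0.
  have /fine_cvgP[xs_fin /cvgrPdist_lt/(_ _ eta0) xsx] :
    f (xs k) @[k --> \oo] --> (fine (f x))%:E by rewrite -fE; exact: f_cont.
  have : \forall k \near \oo,
      f (xs k) \is a fin_num /\ `|fine (f (xs k)) - fine (f x)| < eta.
    near=> k; split; first by near: k.
    by rewrite distrC; near: k.
  by move=> [N _ NP]; exists N; apply: NP => /=.
have k0 : 0 < k.+1%:R^-1 :> R by rewrite invr_gt0.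
have k1 : k.+1%:R^-1 <= 1 :> R by rewrite invf_le1// ler1n.
have k2 : k.+1%:R^-1 ^+ 2 <= 1 :> R by rewrite exprn_ile1// ltW.
(* As [k.+1%:R^-1] is at most 1, this cosine is nonnegative, as convexity of the cone will
   require. *)
exists k.+1%:R^-1, (1 - k.+1%:R^-1 ^+ 2 / 2); split => //.
- by move: k2; move: (_^-1 ^+ 2) => q; lra.
- move=> y yc; rewrite -(subrK x y) [_ - _ + _]addrC; apply: kP.
    exact: open_cone_neq0 yc.
  exact: open_cone_dir_nbhd yc.
Unshelve. all: by end_near. Qed.

(** A point just below the graph over [y] lies outside the closed piece of the epigraph, and so do
    its neighbors; this keeps [f] from dropping near [y]. *)
Lemma dir_lsc_cone : exists e c : R, [/\ 0 < e, 0 <= c, c < 1 &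
  forall y, open_cone e c u (y - x) ->
    [/\ f y \is a fin_num, `|fine (f y) - fine (f x)| <= 1 &
      forall eta, 0 < eta -> \forall z \near y, fine (f y) - eta < fine (f z)]].
Proof.
have [e1 [d1 [e1_gt0 d1_gt0 Cclosed]]] := f_lsc.
(* The 1 gives the stated bound. One half of [e1] is spent on the distance from [f x] to [f y], the
   other on lowering the level to [r]. *)
have m0 : 0 < Num.min 1 (e1 / 2) by rewrite lt_min ltr01 divr_gt0.
have [e2 [c2 [e2_gt0 c2_ge0 c2_lt1 fc]]] := dir_continuous_cone _ m0.
have d1c : 1 - d1 ^+ 2 / 2 < 1 by have := exprn_gt0 2 d1_gt0; lra.
pose e := Num.min e1 e2; pose c := Num.max c2 (1 - d1 ^+ 2 / 2).
have cone1 : open_cone e c u `<=` dir_nbhd e1 d1 u.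
  move=> z zc; apply: open_cone_dir_nbhd => //.
  by apply: open_coneS zc; rewrite ?ge_min ?le_max lexx ?orbT.
have cone2 : open_cone e c u `<=` open_cone e2 c2 u.
  by apply: open_coneS; rewrite ?ge_min ?le_max lexx ?orbT.
exists e, c; split; rewrite ?lt_min ?le_max ?gt_max ?e1_gt0 ?c2_ge0 ?c2_lt1//.
move=> y yc; have [fy] := fc _ (cone2 _ yc).
rewrite lt_min => /andP[fy1 fye]; split=> //; first exact: ltW.
move=> eta eta0; pose r := fine (f y) - Num.min eta (e1 / 2).
have r_lt : r < fine (f y).
  by rewrite ltrBlDr ltrDl lt_min eta0 divr_gt0.
have re : fine (f y) - eta <= r /\ `|fine (f x) - r| < e1.
  have : 0 < Num.min eta (e1 / 2) <= eta /\ Num.min eta (e1 / 2) <= e1 / 2.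
    by rewrite lt_min !ge_min !lexx eta0 divr_gt0//= orbT.
  by move: fye; rewrite /r !ltr_norml; move: (Num.min _ _) => q; lra.
have [r2 r3] := re.
have nC : ~ (epi f `&` (closure (dir_nbhd_at x e1 d1 u) `*`
    closed_ball (fine (f x)) e1)) (y, r).
  by move=> [+ _]; rewrite /epi/= -(fineK fy) lee_fin leNgt; rewrite r_lt.
have : \forall p \near (y, r), ~ (epi f `&` (closure (dir_nbhd_at x e1 d1 u) `*`
    closed_ball (fine (f x)) e1)) p.
  move: Cclosed; rewrite -openC openE; exact.
move=> [[A B]/= [yA rB] AB].
have yO := open_nbhs_nbhs (conj (open_cone_at_open x e c u) yc).
apply: filterS2 yA yO => z Az zc.
have [fz _] := fc _ (cone2 _ zc).
rewrite (le_lt_trans r2)// -lte_fin fineK// ltNge; apply/negP => zr.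
apply: (AB (z, r)); first by split=> //; exact: nbhs_singleton.
split=> //; split.
  apply: subset_closure; exists (z - x); first exact: cone1.
  by rewrite addrC subrK.
by apply: subset_closure; rewrite -ball_normE.
Qed.

End DirectionalContinuity.

(** * The two implications of the equivalence *)

Section SingularSubdifferential.
Context {R : realType} {n : nat}.
Variables (f : 'rV[R]_n -> \bar R) (x u : 'rV[R]_n).
Hypotheses (f_fin : f x \is a fin_num) (u0 : u != 0)
  (f_cont : dir_continuous f x u).

Lemma ex_regular_subgradient (e d : R) : dir_locally_lsc f x u ->
  0 < e -> 0 < d -> exists z xi,
  [/\ z != 0, dir_nbhd e d u z & regular_subdiff f (x + z) xi].
Proof.
move=> f_lsc e_gt0 d_gt0.
have [e1 [c1 [e1_gt0 c1_ge0 c1_lt1 H]]] :=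
  dir_lsc_cone _ _ _ f_fin u0 f_lsc f_cont.
have dc : 1 - d ^+ 2 / 2 < 1 by have := exprn_gt0 2 d_gt0; lra.
pose e2 := Num.min e e1; pose c2 := Num.max c1 (1 - d ^+ 2 / 2).
have cone1 : open_cone e2 c2 u `<=` open_cone e1 c1 u.
  by apply: open_coneS; rewrite ?ge_min ?le_max lexx ?orbT.
have cone2 : open_cone e2 c2 u `<=` dir_nbhd e d u.
  move=> z zc; apply: open_cone_dir_nbhd => //.
  by apply: open_coneS zc; rewrite ?ge_min ?le_max lexx ?orbT.
have e2_gt0 : 0 < e2 by rewrite lt_min e_gt0.
have a0 : 0 < enorm u by rewrite enorm_gt0.
pose t := e2 / 2 / enorm u.
have tu : open_cone e2 c2 u (t *: u).
  apply: open_coneZ; rewrite ?gt_max ?c1_lt1//; first by rewrite !divr_gt0.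
  by rewrite divfK ?gt_eqF// ltr_pdivrMr// ltr_pMr// ltr1n.
have /near_enormP[r r0 rP] := open_cone_near _ _ _ _ tu.
pose p := x + t *: u; pose rho := r / 2.
have rho0 : 0 < rho by rewrite divr_gt0.
have ballP y : enorm (y - p) <= rho -> open_cone e2 c2 u (y - x).
  move=> yp; apply: rP; rewrite -addrA -opprD.
  by apply: le_lt_trans yp _; rewrite ltr_pdivrMr// ltr_pMr// ltr1n.
(* On the cone [f] is within 1 of its value at [x], so it drops by at most 2, less than
   [M * rho ^+ 2 = 3]. *)
have M0 : 0 <= 3 / rho ^+ 2 by rewrite divr_ge0 ?sqr_ge0.
have pp : enorm (p - p) <= rho by rewrite subrr enorm0 ltW.
have [|||y [yp _ [|xi xiP _]]] :=
    @penalized_min _ _ f p rho 0 _ rho0 (lexx 0) M0.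
- by move=> y /ballP/cone1/H[].
- move=> y /ballP/cone1/H[_ _ lsc] eta eta0.
  by apply: filterS (lsc _ eta0) => w + _.
- move=> y /ballP/cone1/H[_ fy _]; have [_ fp _] := H _ (cone1 _ (ballP _ pp)).
  rewrite divfK ?expf_neq0 ?gt_eqF//.
  by move: fy fp; rewrite !ler_norml; lra.
- by left.
have yc := ballP _ (ltW yp).
exists (y - x), xi; split; first exact: open_cone_neq0 yc.
  exact: cone2.
by rewrite addrC subrK.
Qed.

Lemma dir_singular_subdiff0 : dir_locally_lsc f x u ->
  dir_singular_subdiff f x u 0.
Proof.
move=> f_lsc.
have /choice[zs /choice[xis zP]] k : exists z xi, [/\ z != 0,
    dir_nbhd k.+1%:R^-1 k.+1%:R^-1 u z & regular_subdiff f (x + z) xi].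
  by apply: ex_regular_subgradient; rewrite // invr_gt0.
have cvgz : dir_cvg (fun k => x + zs k) x u.
  by apply: dir_cvg_dir_nbhd => // k; case: (zP k).
have N0 k : 0 < enorm (xis k) + 1 by rewrite ltr_wpDl ?enorm_ge0.
(* The subgradients may be unbounded; dividing by [enorm (xis k) + 1] forces the products to 0. *)
exists (fun k => x + zs k), (fun k => k.+1%:R^-1 / (enorm (xis k) + 1)), xis.
split=> //.
- split=> [k|]; first by rewrite divr_gt0// invr_gt0.
  apply: (@squeeze_cvgr _ _ _ _ (fun=> 0) (@harmonic R)).
  + near=> k; rewrite divr_ge0 ?(ltW (N0 k))//=.
    by rewrite ler_pdivrMr// ler_peMr// lerDr enorm_ge0.
  + exact: cvg_cst.
  + exact: cvg_harmonic.
- by move=> k; case: (zP k).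
- apply/cvg_enormP.
  apply: (@squeeze_cvgr _ _ _ _ (fun=> 0) (@harmonic R)).
  + near=> k; rewrite enorm_ge0 subr0 enormZ ger0_norm; last first.
      by rewrite divr_ge0 ?(ltW (N0 k)).
    by rewrite mulrAC ler_pdivrMr// /harmonic/= ler_wpM2l// lerDl.
  + exact: cvg_cst.
  + exact: cvg_harmonic.
- exact: f_cont.
Unshelve. all: by end_near. Qed.

Lemma dir_lipschitz_singular_subdiff : dir_lipschitz f x u ->
  dir_singular_subdiff f x u `<=` [set 0].
Proof.
move=> [L [e [d [L0 e0 d0 fin lip]]]] xi.
move=> [xs [tau [xis [cx [tau0 ctau] sub cxi _]]]].
have dc : 1 - d ^+ 2 / 2 < 1 by have := exprn_gt0 2 d0; lra.
have xs_cone := dir_cvg_open_cone _ _ _ _ _ u0 dc e0 cx.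
have nbh y : open_cone e (1 - d ^+ 2 / 2) u (y - x) -> dir_nbhd_at x e d u y.
  move=> yc; exists (y - x); first exact: open_cone_dir_nbhd.
  by rewrite addrC subrK.
suff c0 : tau k *: xis k @[k --> \oo] --> (0 : 'rV[R]_n).
  exact: (cvg_unique _ cxi c0).
apply/cvg_enormP; rewrite -[X in _ --> X](mul0r L).
apply: (@squeeze_cvgr _ _ _ _ (fun=> 0) (fun k => tau k * L)).
- near=> k; rewrite enorm_ge0/= subr0 enormZ gtr0_norm// ler_pM2l//.
  have xc : open_cone e (1 - d ^+ 2 / 2) u (xs k - x) by near: k.
  apply: (enorm_regular_subdiff_le _ _ _ _ L0 _ (sub k)).
  apply: filterS (open_nbhs_nbhs (conj (open_cone_at_open x e _ u) xc)).
  move=> y /nbh yc; split; first exact: fin.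
  by apply: le_trans (ler_norm _) (lip _ _ yc _); exact: nbh.
- by rewrite mul0r; exact: cvg_cst.
- by apply: cvgMr_tmp.
Unshelve. all: by end_near. Qed.

(** The selection [s] need not be increasing: [k <= s k] already makes it tend to infinity. *)
Lemma dir_cvg_subseq (xs : nat -> 'rV[R]_n) (s : nat -> nat) :
  (forall k, (k <= s k)%N) -> dir_cvg xs x u -> dir_cvg (xs \o s) x u.
Proof.
move=> ks [t [us [[t0 ct] cu xsE]]].
have cs : s @ \oo --> \oo.
  by move=> A [N _ NA]; exists N => // k /= Nk; apply: NA; exact: leq_trans (ks k).
exists (t \o s), (us \o s); split=> [||k]; last exact: xsE.
  by split=> [k|]; [exact: t0|exact: cvg_comp ct].
exact: cvg_comp cu.
Qed.

(** Otherwise some sequence converging in direction [u] carries subgradients of norms tending to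
    infinity. Normalized, they cluster at a singular subgradient, with the inverse norms as [tau];
    it would have to be 0 although it is a limit of unit vectors. *)
Lemma bounded_regular_subdiff : dir_singular_subdiff f x u `<=` [set 0] ->
  exists k, forall z, z != 0 -> dir_nbhd k.+1%:R^-1 k.+1%:R^-1 u z ->
    forall xi, regular_subdiff f (x + z) xi -> enorm xi <= k.+1%:R.
Proof.
move=> sing; apply: (dir_nbhd_dir_cvg x u (fun k y =>
  forall xi, regular_subdiff f y xi -> enorm xi <= k.+1%:R) u0) => xs cx.
apply: contrapT => nP.
have /choice[xis xisP] k : exists xi, regular_subdiff f (xs k) xi /\
    k.+1%:R < enorm xi.
  apply: contrapT => nxi; apply: nP; exists k => xi fxi.
  by rewrite leNgt; apply/negP => xik; apply: nxi; exists xi.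
have xi_gt0 k : 0 < enorm (xis k) by apply: lt_trans (xisP k).2.
pose a k := (enorm (xis k))^-1 *: xis k.
have a1 k : enorm (a k) = 1.
  by rewrite /a enormZ gtr0_norm ?invr_gt0// mulVf ?gt_eqF.
have [|p [_ clp]] := @compact_enorm_ball R n 0 1 (a @ \oo) _.
  by exists 0%N => // k _ /=; rewrite subr0 a1.
have /choice[s sP] j : exists k, (j <= k)%N /\ enorm (a k - p) < j.+1%:R^-1.
  have tail : \forall k \near \oo, exists2 k', (j <= k')%N & a k = a k'.
    by exists j => // k jk; exists k.
  have pn : \forall w \near p, enorm (w - p) < j.+1%:R^-1.
    by apply/near_enormP; exists j.+1%:R^-1 => //; rewrite invr_gt0.
  have [w [[k jk ->] kp]] :=
    clp [set w | exists2 k', (j <= k')%N & w = a k'] _ tail pn.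
  by exists k.
have js j : (j <= s j)%N := (sP j).1.
have /sing/= p0 : dir_singular_subdiff f x u p.
  exists (xs \o s), (fun j => (enorm (xis (s j)))^-1), (xis \o s); split.
  - exact: dir_cvg_subseq.
  - split=> [k|]; first by rewrite invr_gt0.
    apply: (@squeeze_cvgr _ _ _ _ (fun=> 0) (@harmonic R)).
    + near=> k; rewrite invr_ge0 enorm_ge0/= lef_pV2 ?posrE//.
      by apply: le_trans (ltW (xisP (s k)).2); rewrite ler_nat ltnS.
    + exact: cvg_cst.
    + exact: cvg_harmonic.
  - by move=> k; exact: (xisP (s k)).1.
  - apply/cvg_enormP; apply: (@squeeze_cvgr _ _ _ _ (fun=> 0) (@harmonic R)).
    + by near=> k; rewrite enorm_ge0/= ltW//; exact: (sP k).2.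
    + exact: cvg_cst.
    + exact: cvg_harmonic.
  - exact: (f_cont _ (dir_cvg_subseq _ _ js cx)).
(* At [j = 0] the unit vector [a (s 0)] would be at distance less than 1 from 0. *)
have := (sP 0%N).2; rewrite p0 subr0 a1 invr1 ltxx.
Unshelve. all: by end_near. Qed.

Lemma singular_subdiff_dir_lipschitz : dir_locally_lsc f x u ->
  dir_singular_subdiff f x u `<=` [set 0] -> dir_lipschitz f x u.
Proof.
move=> f_lsc sing.
have [e1 [c1 [e1_gt0 c1_ge0 c1_lt1 H]]] :=
  dir_lsc_cone _ _ _ f_fin u0 f_lsc f_cont.
have [k kP] := bounded_regular_subdiff sing.
have k0 : 0 < k.+1%:R^-1 :> R by rewrite invr_gt0.
move: kP k0; set q := k.+1%:R^-1; set L := k.+1%:R => kP q0.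
have L0 : 0 <= L by rewrite ler0n.
have qc : 1 - q ^+ 2 / 2 < 1 by have := exprn_gt0 2 q0; lra.
pose e := Num.min e1 q; pose c := Num.max c1 (1 - q ^+ 2 / 2).
have e0 : 0 < e by rewrite lt_min e1_gt0.
have c0 : 0 <= c by rewrite le_max c1_ge0.
have c_lt1 : c < 1 by rewrite gt_max c1_lt1.
have cone1 : open_cone e c u `<=` open_cone e1 c1 u.
  by apply: open_coneS; rewrite ?ge_min ?le_max lexx ?orbT.
have cone2 : open_cone e c u `<=` dir_nbhd q q u.
  move=> z zc; apply: open_cone_dir_nbhd => //.
  by apply: open_coneS zc; rewrite ?ge_min ?le_max lexx ?orbT.
clearbody e c.
have lipO a b : open_cone e c u (a - x) -> open_cone e c u (b - x) ->
    fine (f a) - fine (f b) <= (L + 1) * enorm (a - b).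
  (* The drop is at most 2 because all values are within 1 of that at [x]; [L + 1] serves as a
     constant above [L]. *)
  apply: (lipschitz_of_subdiff_bound f
    [set y | open_cone e c u (y - x)] 2 (L + 1) L).
  - exact: open_cone_at_open.
  - move=> a' b' s a'c b'c s01 /=.
    have -> : a' + s *: (b' - a') - x =
        (a' - x) + s *: ((b' - x) - (a' - x)).
      by apply/rowP => i; rewrite !mxE; ring.
    exact: open_cone_convex.
  - by rewrite addr_ge0.
  - by rewrite ltrDl.
  - move=> y /= yc; have [fy fyx lsc] := H _ (cone1 _ yc); split=> //.
      move=> w /cone1/H[_ fwx _].
      by move: fyx fwx; rewrite !ler_norml; lra.
    move=> xi; rewrite -(subrK x y) [_ - _ + _]addrC; apply: kP.
      exact: open_cone_neq0 yc.
    exact: cone2.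
have lipOx y : open_cone e c u (y - x) ->
    `|fine (f y) - fine (f x)| <= (L + 1) * enorm (y - x).
  move=> yc; apply/ler_addgt0Pr => eta eta0.
  have eta2 : 0 < eta / 2 by rewrite divr_gt0.
  have [e2 [c2 [e2_gt0 c2_ge0 c2_lt1 fc]]] :=
    dir_continuous_cone _ _ _ f_fin u0 f_cont _ eta2.
  have a0 : 0 < enorm u by rewrite enorm_gt0.
  (* The tip [x] is outside the cone, so it is replaced by the point [w] of the axis at distance
     [m]. The detour and the change of [f] from [w] to [x] cost at most [eta / 2] each. *)
  have [m [m0 me me2 mL]] : exists m, [/\ 0 < m, m < e, m < e2 &
      (L + 1) * m <= eta / 2].
    exists (Num.min (Num.min e e2) (eta / 2 / (L + 1)) / 2).
    have L1 : 0 < L + 1 by rewrite ltr_wpDl.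
    have q0' : 0 < eta / 2 / (L + 1) by rewrite divr_gt0.
    have [h1 h2 h3 h4] : [/\ 0 < Num.min (Num.min e e2) (eta / 2 / (L + 1)),
        Num.min (Num.min e e2) (eta / 2 / (L + 1)) <= e,
        Num.min (Num.min e e2) (eta / 2 / (L + 1)) <= e2 &
        Num.min (Num.min e e2) (eta / 2 / (L + 1)) <= eta / 2 / (L + 1)].
      by rewrite !lt_min e0 e2_gt0 q0' !ge_min !lexx !orbT.
    move: h1 h2 h3 h4; move: (Num.min _ _) => m h1 h2 h3.
    rewrite ler_pdivlMr// => h4; split; lra.
  pose w := x + (m / enorm u) *: u.
  have wx : w - x = (m / enorm u) *: u by rewrite /w addrC addKr.
  have wn : enorm (w - x) = m.
    by rewrite wx enormZ gtr0_norm ?divr_gt0// divfK ?gt_eqF.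
  have wc : open_cone e c u (w - x).
    by rewrite wx; apply: open_coneZ; rewrite ?divr_gt0// divfK ?gt_eqF.
  have [_ fw] : f w \is a fin_num /\ `|fine (f w) - fine (f x)| < eta / 2.
    apply: fc; rewrite wx.
    by apply: open_coneZ; rewrite ?divr_gt0// divfK ?gt_eqF.
  have yw : enorm (y - w) <= enorm (y - x) + m.
    have -> : y - w = (y - x) + (x - w) by rewrite addrA subrK.
    by rewrite -wn (enormBC w); exact: enormD.
  have yw' : (L + 1) * enorm (y - w) <= (L + 1) * enorm (y - x) + eta / 2.
    apply: (@le_trans _ _ ((L + 1) * (enorm (y - x) + m))).
      by rewrite ler_wpM2l// addr_ge0.
    by rewrite mulrDr lerD2l.
  have h1 := lipO _ _ yc wc; have := lipO _ _ wc yc; rewrite enormBC => h2.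
  by move: fw; rewrite ltr_norml ler_norml; lra.
(* With [delta = 1 - c], the cosine [1 - delta ^+ 2 / 2] exceeds [c] by [(1 - c) * (1 + c) / 2],
   which is positive. *)
have near_cone y : dir_nbhd_at x e (1 - c) u y ->
    y = x \/ open_cone e c u (y - x).
  move=> [z zP <-]; have [->|z0] := eqVneq z 0; first by left; rewrite addr0.
  right; rewrite addrC addKr; apply: dir_nbhd_open_cone zP => //.
    by rewrite subr_gt0.
  have : 0 < (1 - c) * (1 + c) by apply: mulr_gt0; lra.
  by lra.
exists (L + 1), e, (1 - c); split; rewrite ?addr_ge0 ?subr_gt0//.
  by move=> y /near_cone[->//|/cone1/H[]].
move=> y z /near_cone[->|yc] /near_cone[->|zc].
- by rewrite !subrr normr0 enorm0 mulr0.
- by rewrite distrC enormBC; exact: lipOx.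
- exact: lipOx.
- have h1 := lipO _ _ yc zc; have := lipO _ _ zc yc.
  by rewrite (enormBC z) ler_norml => h2; apply/andP; split; lra.
Qed.

End SingularSubdifferential.

Theorem proposition2p4 (R : realType) (n : nat) (f : 'rV[R]_n -> \bar R)
    (xbar u : 'rV[R]_n) (f_fin : f xbar \is a fin_num) (u_neq0 : u <> 0)
    (f_lsc : dir_locally_lsc f xbar u) (f_cont : dir_continuous f xbar u) :
  dir_lipschitz f xbar u <-> dir_singular_subdiff f xbar u = [set 0].
Proof.
have u0 : u != 0 by apply/eqP.
split=> [lip|sing].
  rewrite eqEsubset; split; first exact: dir_lipschitz_singular_subdiff.
  by move=> _ ->; exact: dir_singular_subdiff0.
by apply: singular_subdiff_dir_lipschitz; rewrite // sing.
Qed.
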